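(* Let $K$ be a prime link diagram without curls, let $i\in K_1$ be a segment, let $L(i)$ be the lattice of Kauffman states of $K$ relative to $i$, and let $T(i)$ be the associated representation with $d_j=\dim T(i)_j$. For $j\in K_1$ and $1\le k\le d_j$ let $M(j,k)$ be the submodule of $T(i)$ generated by $\{b_{j,1},\dots,b_{j,k}\}$. Then: (a) The join irreducibles of $L(i)$ correspond to the modules $M(j,k)$ (with $j\in K_1$, $1\le k\le d_j$) under the isomorphism $\Phi$ between $L(i)$ and the submodule lattice of $T(i)$. (b) The unique descent at $M(j,k)$ is labeled $j$. (c) The join irreducibles with unique descent $j$ form a linear subposet of $L(i)$: $M(j,1)\subset M(j,2)\subset\dots\subset M(j,d_j)$.
   Context: Link diagrams. A link diagram $K$ is a projection of a link to the plane that is injective except for finitely many transversal double points (crossing points). It is regarded as a cellular decomposition of the oriented sphere $S^2$: $K_0$ is the set of crossing points (nonempty), $K_1$ the set of segments (edges; every crossing point is incident to four segments and every segment to two crossing points), $K_2$ the set of regions of the complement; $|K_1|=2|K_0|$ and $|K_2|=|K_0|+2$ (so $K$ is connected). A curl is a monogon region; $K$ is without curls if it has no monogon. ''Prime link diagram'' means: the link is prime (not the connected sum of two nontrivial links), and the diagram is prime, i.e. every simple closed curve in $S^2$ meeting $K$ transversally in exactly two points, both interior points of segments, bounds on one side a disc containing no crossing points. ''Clockwise'' is with respect to the fixed orientation of the plane. Kauffman states. Let $i\in K_1$, with adjacent regions $R_i,R_i'$. A marker is a pair $(x,R)$ with $x\in K_0$, $R\in K_2$, $x$ incident to $R$. A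 Kauffman state relative to $i$ is a set of markers such that each crossing point is used in exactly one marker, each region other than $R_i,R_i'$ is used in exactly one marker, and $R_i,R_i'$ are used in no marker. Let $j$ be a segment with endpoints $x,y$ and adjacent regions $R_1,R_2$ such that going clockwise around $x$ one passes from $R_1$ to $R_2$ when crossing $j$. A state $\mathcal S'$ is obtained from $\mathcal S$ by a counterclockwise transposition at $j$ if $\mathcal S$ contains $(x,R_2),(y,R_1)$, $\mathcal S'$ contains $(x,R_1),(y,R_2)$, and all other markers agree. Put $\mathcal S_1<\mathcal S_2$ if a (nonempty) sequence of counterclockwise transpositions transforms $\mathcal S_1$ into $\mathcal S_2$. This is a partial order with a unique minimal and a unique maximal element (Kauffman); the resulting poset $L(i)$ is a lattice. Each edge of its Hasse diagram is a transposition at some segment and is labeled by that segment. The quiver $Q$. Its vertices are the segments, $Q_0=K_1$. For every crossing point with segments $a_1,a_2,a_3,a_4$ in clockwise order draw arrows $a_1\to a_2\to a_3\to a_4\to a_1$; then remove all 2-cycles. Each remaining arrow $\alpha:j\to k$ corresponds to a position $(x,R)$ in the diagram: the region $R$ at the crossing point $x$ lying between $j$ and the next segment $k$ in clockwise direction. The representation $T(i)=(T(i)_j,\phi_\alpha)$ of $Q$ over an algebraically closed field $\Bbbk$. For $j\in K_1$ let $d_j=\dim T(i)_j$ be the number of transpositions at $j$ in any sequence of counterclockwise transpositions from the minimal to the maximal Kauffman state relative to $i$ (this number does not depend on the sequence). $T(i)_j$ is the $\Bbbk$-vector space with basis $B(i)_j=\{b_{j,1},\dots,b_{j,d_j}\}$.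 For every arrow $\alpha:j\to k$ one has $|d_j-d_k|\le 1$, and $\phi_\alpha:T(i)_j\to T(i)_k$ is given by: - if $d_k=d_j+1$: $\phi_\alpha(b_{j,m})=b_{k,m}$ for all $m$; - if $d_k=d_j-1$: $\phi_\alpha(b_{j,m})=b_{k,m-1}$ for $m\ge2$ and $\phi_\alpha(b_{j,1})=0$; - if $d_k=d_j$ and the position $(x,R)$ corresponding to $\alpha$ is a marker of the minimal Kauffman state: $\phi_\alpha(b_{j,m})=b_{k,m-1}$ for $m\ge2$ and $\phi_\alpha(b_{j,1})=0$ (nilpotent Jordan block); - if $d_k=d_j$ and $(x,R)$ is not a marker of the minimal Kauffman state: $\phi_\alpha(b_{j,m})=b_{k,m}$ for all $m$ (identity). The isomorphism $\Phi$ (known from earlier work). There is an isomorphism of posets $\Phi$ from $L(i)$ to the poset of submodules of $T(i)$ ordered by inclusion, such that $\mathcal S'$ is obtained from $\mathcal S$ by a counterclockwise transposition at $j$ if and only if $M=\Phi(\mathcal S)\subset M'=\Phi(\mathcal S')$ satisfy $M'_k=M_k$ for $k\ne j$ and $\dim M'_j=\dim M_j+1$. Equivalently, $\dim\Phi(\mathcal S)_j$ is the number of transpositions at $j$ in a sequence of counterclockwise transpositions from the minimal state to $\mathcal S$. Elements of $L(i)$ are identified with submodules via $\Phi$. Join irreducibles. An element $c$ of a lattice is join irreducible if it is not the minimum and $c=a\vee b$ implies $c=a$ or $c=b$. In the Hasse diagram these are the elements with exactly one edge going down; this edge is called the descent at $c$. *)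

(* Defs.v *)
From HB Require Import structures.
From mathcomp Require Import all_boot all_order all_algebra.
From mathcomp Require Import all_classical all_reals all_analysis.

Set Implicit Arguments.
Unset Strict Implicit.
Unset Printing Implicit Defensive.

Import Order.TTheory GRing.Theory Num.Theory.
Import numFieldNormedType.Exports.

Local Open Scope ring_scope.

(* A dart (x, k) is the k-th of the four segment ends at the crossing point x,
   numbered in clockwise order.  It also names a corner at x: the one met
   between the ends k and k + 1 when going clockwise around x.                *)
Definition dart_of (X : Type) := (X * 'I_4)%type.

Definition cw (X : Type) (d : dart_of X) : dart_of X := (d.1, ordS d.2).
Definition ccw (X : Type) (d : dart_of X) : dart_of X := (d.1, ord_pred d.2).

(* [other_end] sends an end of a segment to the other end of that segment.  Leaving x
   along d, the corner d lies on the right hand side; arriving at the other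
   crossing point along [other_end d], the corner on the same side is [ccw (other_end d)].
   Hence the regions are the orbits of [ccw \o other_end].
   Crossing information: the strand through the ends 0 and 2 is the under
   strand, the one through the ends 1 and 3 is the over strand.               *)
Record link_diagram := LinkDiagram {
  crossing : finType;
  segment : finType;
  region : finType;
  other_end : dart_of crossing -> dart_of crossing;
  seg : dart_of crossing -> segment;
  reg : dart_of crossing -> region;
  crossing_gt0 : (0 < #|crossing|)%N;
  other_endK : involutive other_end;
  other_end_neq : forall d, other_end d != d;
  seg_surj : forall j, exists d, seg d = j;
  segP : forall d e, seg d = seg e <-> e = d \/ e = other_end d;
  reg_surj : forall r, exists d, reg d = r;
  regP : forall d e, reg d = reg e <-> fconnect (fun d' => ccw (other_end d')) d e;
  diagram_connected : forall x y,
    connect (fun x' y' => [exists k, (other_end (x', k)).1 == y']) x y;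
  diagram_euler : #|region| = (#|crossing| + 2)%N
}.

Arguments other_end {l} _.
Arguments seg {l} _.
Arguments reg {l} _.

Notation dart K := (dart_of (crossing K)).

(* A monogon is a region with a single corner. *)
Definition without_curls (K : link_diagram) : Prop :=
  forall r : region K, #|[pred d : dart K | reg d == r]| != 1%N.

(* A simple closed curve meeting K transversally in exactly two interior points
   of segments: it crosses the segment of d from the region [reg d] on its right
   to the region [reg (other_end d)] on its left, and then crosses the segment of e,
   again from right to left, back to the region where it started.             *)
Definition two_point_curve (K : link_diagram) (d e : dart K) : Prop :=
  reg (other_end d) = reg e /\ reg (other_end e) = reg d.

(* If the two segments are distinct, each of them is crossed once, so it has an
   end point on either side of the curve and both discs contain a crossing
   point.  If they coincide, one of the discs contains only the part of that
   segment between the two intersection points.                               *)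
Definition prime_diagram (K : link_diagram) : Prop :=
  forall d e : dart K, two_point_curve d e -> seg d = seg e.

Section Links.
Variable R : realType.

(* The projection of a link is its image under [fst]; [snd] is the height. *)
Definition plane := (R * R)%type.
Definition space3 := (plane * R)%type.

Definition ambient_isotopic (L L' : set space3) : Prop :=
  exists H : R -> space3 -> space3,
    [/\ continuous (fun p : R * space3 => H p.1 p.2),
        (forall t, exists G : space3 -> space3,
           [/\ cancel (H t) G, cancel G (H t) & continuous G]),
        H 0 = id
      & image L (H 1) = L'].

Definition unlink (n : nat) : set space3 :=
  [set z | exists2 k, (k < n)%N &
     (z.1.1 - 3 * k%:R) ^+ 2 + z.1.2 ^+ 2 = 1 /\ z.2 = 0]%classic.

Definition trivial_link (L : set space3) : Prop :=
  exists2 n, (0 < n)%N & ambient_isotopic (unlink n) L.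

Definition line_segment (p q : space3) : set space3 :=
  [set z | exists2 t : R, 0 <= t <= 1 & z = (1 - t) *: p + t *: q]%classic.

(* Near p, the link is the straight line through p orthogonal to the plane of
   equation z.1.1 = p.1.1.                                                    *)
Definition crosses_orthogonally (L : set space3) (p : space3) : Prop :=
  exists2 e : R, 0 < e &
    forall z, `|z - p| < e -> (L z <-> z.1.2 = p.1.2 /\ z.2 = p.2).

(* Up to isotopy, L meets the plane of equation z.1.1 = 0 in two points p, q;
   the two summands are obtained by cutting L along this plane and closing each
   half with the line segment from p to q.                                    *)
Definition connected_sum (L L1 L2 : set space3) : Prop :=
  exists (L' : set space3) (p q : space3),
    [/\ ambient_isotopic L L',
        p <> q /\ (forall z, (L' z /\ z.1.1 = 0) <-> (z = p \/ z = q)),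
        crosses_orthogonally L' p /\ crosses_orthogonally L' q,
        L1 = ([set z | L' z /\ z.1.1 <= 0%R] `|` line_segment p q)%classic
      & L2 = ([set z | L' z /\ 0%R <= z.1.1] `|` line_segment p q)%classic].

Definition prime_link (L : set space3) : Prop :=
  forall L1 L2, connected_sum L L1 L2 -> trivial_link L1 \/ trivial_link L2.

(* L is a link whose regular projection is the diagram K: [gamma d]
   parametrizes the piece of L above the segment of d, starting at d; [c x] is
   the position of the crossing point x, near which the projection consists of
   two straight lines with directions [v].  The determinant condition says that
   [cw] turns clockwise when the plane is seen from above.                    *)
Definition is_diagram_of (K : link_diagram) (L : set space3) : Prop :=
  exists (gamma : dart K -> R -> space3) (c : crossing K -> plane)
         (v : dart K -> plane) (e : R),
    [/\ [/\ (forall d, {within `[0, 1], continuous (gamma d)}%classic),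
            (forall d t, 0 <= t <= 1 -> gamma (other_end d) t = gamma d (1 - t))
          & (forall d d' s t, 0 < s < 1 -> 0 <= t <= 1 ->
               (gamma d s).1 = (gamma d' t).1 ->
               (d' = d /\ t = s) \/ (d' = other_end d /\ t = 1 - s))],
        [/\ injective c,
            0 < e <= 1
          & (forall d t, 0 <= t <= e -> (gamma d t).1 = c d.1 + t *: v d)],
        (forall d, v (cw (cw d)) = - v d) /\
        (forall d, (v d).1 * (v (cw d)).2 - (v d).2 * (v (cw d)).1 < 0),
        (forall d, gamma (cw (cw d)) 0 = gamma d 0) /\
        (forall d : dart K, ~~ odd d.2 -> (gamma d 0).2 < (gamma (cw d) 0).2)
      & L = [set z | exists d, exists2 t, 0 <= t <= 1 & z = gamma d t]%classic].

Definition prime_link_diagram (K : link_diagram) : Prop :=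
  prime_diagram K /\ (exists2 L, is_diagram_of K L & prime_link L).

End Links.

Section Joins.
Variables (T : Type) (le : T -> T -> Prop).

Definition is_minimum (x : T) : Prop := forall y, le x y.
Definition is_maximum (x : T) : Prop := forall y, le y x.

Definition is_join (a b c : T) : Prop :=
  [/\ le a c, le b c & forall u, le a u -> le b u -> le c u].

Definition join_irreducible (c : T) : Prop :=
  ~ is_minimum c /\ (forall a b, is_join a b c -> c = a \/ c = b).

End Joins.

Section States.
Variables (K : link_diagram) (i : segment K).

Definition marker := (crossing K * region K)%type.

Definition incident (m : marker) : bool := [exists k, reg (m.1, k) == m.2].

(* The two regions adjacent to i: those on the right of its two darts. *)
Definition adjacent_region (r : region K) : bool :=
  [exists d, (seg d == i) && (reg d == r)].

Definition is_state (S : {set marker}) : bool :=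
  [&& [forall m in S, incident m],
      [forall x, #|[set m in S | m.1 == x]| == 1%N]
    & [forall r, #|[set m in S | m.2 == r]| == ~~ adjacent_region r]].

Definition state := {S : {set marker} | is_state S}.

(* Here x = d.1 and y = (other_end d).1; going clockwise around x one passes from
   [reg (ccw d)] to [reg d] when crossing j = seg d.                          *)
Definition ccw_transposition (j : segment K) (S S' : state) : Prop :=
  exists d : dart K, let x := d.1 in let y := (other_end d).1 in
    let R1 := reg (ccw d) in let R2 := reg d in
    [/\ seg d = j,
        (x, R2) \in val S /\ (y, R1) \in val S,
        (x, R1) \in val S' /\ (y, R2) \in val S'
      & val S :\: [set (x, R2); (y, R1)] = val S' :\: [set (x, R1); (y, R2)]].

(* w lists the segments of a sequence of transpositions from S to S'. *)
Fixpoint transpositions (w : seq (segment K)) (S S' : state) : Prop :=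
  if w is j :: w' then
    exists2 S1, ccw_transposition j S S1 & transpositions w' S1 S'
  else S = S'.

Definition state_lt (S S' : state) : Prop :=
  exists2 w, w != [::] & transpositions w S S'.

Definition state_le (S S' : state) : Prop := S = S' \/ state_lt S S'.

Definition state_covers (S' S : state) : Prop :=
  state_lt S' S /\ ~ (exists S'', state_lt S' S'' /\ state_lt S'' S).

(* Exactly one edge of the Hasse diagram goes down from S, and j is its label. *)
Definition unique_descent (S : state) (j : segment K) : Prop :=
  exists S', (forall S'', state_covers S'' S <-> S'' = S') /\
             (forall j', ccw_transposition j' S' S <-> j' = j).

(* The number d_j.  It does not depend on the sequence w, so that the set below
   has exactly one element.                                                   *)
Definition dimT (j : segment K) : nat :=
  xget 0%N [set n | exists Smin Smax w,
    [/\ is_minimum state_le Smin, is_maximum state_le Smax,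
        transpositions w Smin Smax & n = count_mem j w]]%classic.

Definition min_marker (m : marker) : bool :=
  `[< exists2 Smin, is_minimum state_le Smin & m \in val Smin >].

End States.

Record quiver := Quiver {
  vertex : finType;
  arrow : finType;
  source : arrow -> vertex;
  target : arrow -> vertex
}.

Record representation (F : fieldType) (Q : quiver) := Representation {
  rep_space : vertex Q -> vectType F;
  rep_map : forall a : arrow Q, 'Hom(rep_space (source a), rep_space (target a))
}.

Section Submodules.
Variables (F : fieldType) (Q : quiver) (T : representation F Q).

Definition subfamily := forall j : vertex Q, {vspace rep_space T j}.

Definition is_submodule (N : subfamily) : Prop :=
  forall a : arrow Q, (rep_map T a @: N (source a) <= N (target a))%VS.

Definition sub_le (N N' : subfamily) : Prop := forall j, (N j <= N' j)%VS.
Definition sub_eq (N N' : subfamily) : Prop := forall j, N j = N' j.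
Definition sub_lt (N N' : subfamily) : Prop := sub_le N N' /\ ~ sub_eq N N'.

(* The submodule generated by X: the intersection of those containing X. *)
Definition generated (j : vertex Q) (X : seq (rep_space T j)) : subfamily :=
  fun l => xget 0%VS [set U : {vspace rep_space T l} |
    forall u, u \in U <-> (forall N : subfamily, is_submodule N ->
                             {subset X <= N j} -> u \in N l)]%classic.

End Submodules.

(* The dart d carries an arrow from [seg d] to [seg (cw d)], at the position
   (d.1, reg d); it is kept if no arrow goes the other way.  In a prime diagram
   without curls this cancels arrows in pairs: there are no parallel arrows
   among those on a 2-cycle.                                                  *)
Definition in_two_cycle (K : link_diagram) (d : dart K) : bool :=
  [exists e : dart K, (seg e == seg (cw d)) && (seg (cw e) == seg d)].

Definition diagram_quiver (K : link_diagram) : quiver :=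
  @Quiver (segment K) {d : dart K | ~~ in_two_cycle d}
    (fun a => seg (val a)) (fun a => seg (cw (val a))).

(* Matrices acting on row vectors: b_m |-> b_m, and b_m |-> b_(m-1), b_1 |-> 0. *)
Definition keep_mx (F : fieldType) (m n : nat) : 'M[F]_(m, n) :=
  \matrix_(p, q) (p == q :> nat)%:R.
Definition shift_mx (F : fieldType) (m n : nat) : 'M[F]_(m, n) :=
  \matrix_(p, q) (p == q.+1 :> nat)%:R.

Section RepT.
Variables (F : fieldType) (K : link_diagram) (i : segment K).

(* The last branch is never reached, because |d_j - d_k| <= 1. *)
Definition T_mx (d : dart K) : 'M[F]_(dimT i (seg d), dimT i (seg (cw d))) :=
  let dj := dimT i (seg d) in let dk := dimT i (seg (cw d)) in
  if dk == dj.+1 then keep_mx F dj dk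
  else if dj == dk.+1 then shift_mx F dj dk
  else if dk == dj then
    if min_marker i (d.1, reg d) then shift_mx F dj dk else keep_mx F dj dk
  else 0.

Definition T_rep : representation F (diagram_quiver K) :=
  @Representation F (diagram_quiver K)
    (fun j : segment K => 'rV[F]_(dimT i j))
    (fun a => linfun (mulmxr (T_mx (val a)))).

(* The basis vector b_(j, m + 1): indices start at 0 here. *)
Definition T_basis (j : segment K) (m : 'I_(dimT i j)) : rep_space T_rep j :=
  delta_mx 0 m.

Definition M_sub (j : segment K) (k : nat) : subfamily T_rep :=
  @generated F (diagram_quiver K) T_rep j
    [seq T_basis m | m : 'I_(dimT i j) <- enum 'I_(dimT i j) & (m < k)%N].

(* Phi is an isomorphism from L(i) to the poset of submodules of T(i), under
   which the transpositions at j correspond to the inclusions of submodules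
   that add one dimension at j.                                               *)
Definition kauffman_isomorphism (Phi : state i -> subfamily T_rep) : Prop :=
  [/\ (forall S, is_submodule (Phi S)),
      (forall N, is_submodule N -> exists S, sub_eq (Phi S) N),
      (forall S S', sub_eq (Phi S) (Phi S') -> S = S'),
      (forall S S', state_le S S' <-> sub_le (Phi S) (Phi S'))
    & (forall j S S', ccw_transposition j S S' <->
         [/\ sub_le (Phi S) (Phi S'),
             (forall k, k != j -> Phi S' k = Phi S k)
           & \dim (Phi S' j) = (\dim (Phi S j)).+1])].

End RepT.

(* Main.v *)
Require Import Defs.
From mathcomp Require Import all_boot all_order all_algebra.
From mathcomp Require Import all_classical all_reals all_analysis.

(** For every k the vectors b_(l,m) with m <= k span a submodule of T(i), because
    every phi_alpha sends b_m to b_m, to b_(m-1) or to 0; hence M(j,k)_j is the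
    span U_k of b_(j,1), ..., b_(j,k).  Combinatorially, a state has at most one
    predecessor by a transposition at j.  So if P is generated by vectors at j,
    then P has a single maximal submodule, as its descents are all labeled j.
    Applied to the submodule generated by U_k and N_j, where k = dim N_j, this
    gives N_j = U_k for every submodule N.  The three assertions follow. *)

Set Implicit Arguments.
Unset Strict Implicit.
Unset Printing Implicit Defensive.

Import GRing.Theory.
Local Open Scope ring_scope.

(** * Intersections of subspaces and generated submodules *)

(** The family [A] may be infinite, so [U] is taken as a common lower bound of maximal dimension. If
    [u] lies in every member, [U + <[u]>] is again a lower bound, and maximality forces [u] into
    [U]. *)
Lemma bigcapv_exists (F : fieldType) (vT : vectType F)
    (A : {vspace vT} -> Prop) :
  exists U : {vspace vT}, forall u, u \in U <-> (forall V, A V -> u \in V).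
Proof.
pose below (U : {vspace vT}) := forall V, A V -> (U <= V)%VS.
pose P n := `[< exists2 U, below U & \dim U = n >].
have exP : exists n, P n.
  by exists 0%N; apply/asboolP; exists 0%VS; rewrite ?dimv0// => V _; exact: sub0v.
have ubP n : P n -> (n <= \dim {:vT})%N.
  by move=> /asboolP[U _ <-]; exact: dimvS (subvf U).
have [n /asboolP[U belowU dimU] maxn] := ex_maxnP exP ubP.
exists U => u; split=> [uU V AV|uA]; first exact: subvP (belowU V AV) _ uU.
have belowUu : below (U + <[u]>)%VS.
  by move=> V AV; rewrite subv_add belowU// -memvE uA.
have /eqP -> : U == (U + <[u]>)%VS.
  rewrite eqEdim addvSl/= dimU; apply: maxn.
  by apply/asboolP; exists (U + <[u]>)%VS.
by rewrite memvE addvSr.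
Qed.

Section Generated.
Variables (F : fieldType) (Q : quiver) (T : representation F Q).

Lemma sub_le_anti (N N' : subfamily T) : sub_le N N' -> sub_le N' N -> sub_eq N N'.
Proof. by move=> le le' j; apply/eqP; rewrite eqEsubv le le'. Qed.

Lemma sub_le_trans (N1 N2 N3 : subfamily T) :
  sub_le N1 N2 -> sub_le N2 N3 -> sub_le N1 N3.
Proof. by move=> le12 le23 j; exact: subv_trans (le12 j) (le23 j). Qed.

Lemma sub_eq_le (N N' : subfamily T) : sub_eq N N' -> sub_le N N'.
Proof. by move=> e j; rewrite e. Qed.

Lemma sub_eq_sym (N N' : subfamily T) : sub_eq N N' -> sub_eq N' N.
Proof. by move=> e j; rewrite e. Qed.

Definition sub_add (N N' : subfamily T) : subfamily T := fun j => (N j + N' j)%VS.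

Lemma sub_add_submodule (N N' : subfamily T) :
  is_submodule N -> is_submodule N' -> is_submodule (sub_add N N').
Proof. by move=> mN mN' a; rewrite limgD addvS. Qed.

Lemma zero_submodule : is_submodule (fun j => 0%VS : {vspace rep_space T j}).
Proof. by move=> a; rewrite limg0 subvv. Qed.

Variables (j : vertex Q) (X : seq (rep_space T j)).

(** The intersection exists as a subspace, so the [xget] in [generated] never falls back on its
    default value 0. *)
Lemma generatedP l u :
  u \in generated X l <->
  (forall N : subfamily T, is_submodule N -> {subset X <= N j} -> u \in N l).
Proof.
have [U UP] := bigcapv_exists
  (fun V => exists N : subfamily T, [/\ is_submodule N, {subset X <= N j} & V = N l]).
rewrite /generated; case: xgetP => [V _ /(_ u)//|/(_ U) []] /=.
move=> v; rewrite UP; split=> [h N mN XN|h V [N [mN XN ->]]]; last exact: h.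
by apply: h; exists N.
Qed.

Lemma generated_submodule : is_submodule (generated X).
Proof.
move=> a; apply/subvP => _ /memv_imgP[u /generatedP uX ->]; apply/generatedP => N mN XN.
exact: subvP (mN a) _ (memv_img _ (uX N mN XN)).
Qed.

Lemma subset_generated : {subset X <= generated X j}.
Proof. by move=> u Xu; apply/generatedP => N _; apply. Qed.

Lemma generated_le (N : subfamily T) :
  is_submodule N -> {subset X <= N j} -> sub_le (generated X) N.
Proof. by move=> mN XN l; apply/subvP => u /generatedP; apply. Qed.

End Generated.

(** * Transpositions of Kauffman states *)

Section Transpositions.
Variables (K : link_diagram) (i : segment K).
Implicit Types S : state i.

Lemma reg_ccw_other_end (d : dart K) : reg (ccw (other_end d)) = reg d.
Proof. by apply/esym/regP; exact: fconnect1. Qed.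

(** The source is computed from the target and one fixed end [d] of the segment. Hence a state has
    at most one predecessor by a transposition at a given segment. *)
Lemma transposition_source (d : dart K) S S' : ccw_transposition (seg d) S S' ->
  val S = (val S' :\: [set (d.1, reg (ccw d)); ((other_end d).1, reg d)])
          :|: [set (d.1, reg d); ((other_end d).1, reg (ccw d))].
Proof.
case=> e [/segP ed]; set a := (e.1, reg e); set b := ((other_end e).1, reg (ccw e)).
move=> -[aS bS] _ eqS.
have -> : val S = (val S :\: [set a; b]) :|: [set a; b].
  apply/setP => m; rewrite !inE orbC.
  by case: eqP => [->|_]; [rewrite aS|case: eqP => [->|_]; rewrite ?bS ?orbF].
rewrite eqS; case: ed => ->; first by [].
(* If the transposition is described from the other end of the segment, the two markers of each pair
   merely change places. *)
rewrite /a /b other_endK reg_ccw_other_end -(reg_ccw_other_end (other_end e))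
  other_endK; congr (_ :\: _ :|: _); exact: finset.setUC.
Qed.

Lemma transposition_inj j S1 S2 S :
  ccw_transposition j S1 S -> ccw_transposition j S2 S -> S1 = S2.
Proof.
have [d <-] := seg_surj j => /transposition_source e1 /transposition_source e2.
by apply: val_inj; rewrite e1 e2.
Qed.

Lemma transpositions_rcons w j S S' :
  transpositions (rcons w j) S S' <->
  exists2 S1, transpositions w S S1 & ccw_transposition j S1 S'.
Proof.
elim: w S => [|k w IH] S /=.
  by split=> [[S1 t <-]|[S1 <- t]]; [exists S|exists S'].
split=> [[S1 t /IH[S2 w2 t2]]|[S2 [S1 t w2] t2]].
  by exists S2 => //; exists S1.
by exists S1 => //; apply/IH; exists S2.
Qed.

Lemma transposition_lt j S S' : ccw_transposition j S S' -> state_lt S S'.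
Proof. by move=> t; exists [:: j] => //=; exists S'. Qed.

Lemma state_lt_last S S' : state_lt S S' ->
  exists j S1, state_le S S1 /\ ccw_transposition j S1 S'.
Proof.
case=> w; case/lastP: w => // w j _ /transpositions_rcons[S1 wS1 t].
exists j, S1; split=> //; case: w wS1 => [|k w] wS1; first by left.
by right; exists (k :: w).
Qed.

(** In a sequence of two or more transpositions, the state after the first one would lie strictly in
    between. *)
Lemma state_covers_transposition S S' : state_covers S S' ->
  exists j, ccw_transposition j S S'.
Proof.
case=> -[[//|j [|k w]] _ /= [S1 t]]; first by move=> <-; exists j.
move=> h []; exists S1; split; first exact: transposition_lt t.
by exists (k :: w).
Qed.

End Transpositions.

(** * The standard flag of T(i) and the modules M(j,k) *)

Section StandardFlag.
Variables (F : fieldType) (K : link_diagram) (i : segment K).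
Local Notation T := (T_rep F i).

(** Indices start at 0, so [m < k] selects b_(j,1), ..., b_(j,k), and the whole basis once k >= d_j.
    This is the generating list of [M_sub]. *)
Definition flag_basis (j : segment K) (k : nat) : seq (rep_space T j) :=
  [seq T_basis F m | m : 'I_(dimT i j) <- enum 'I_(dimT i j) & (m < k)%N].

Definition flag (k : nat) : subfamily T := fun j => <<flag_basis j k>>%VS.

Lemma mem_flag_basis j k (m : 'I_(dimT i j)) : (m < k)%N ->
  T_basis F m \in flag_basis j k.
Proof. by move=> mk; apply: map_f; rewrite mem_filter mk mem_enum. Qed.

Lemma flag_leP j k (V : {vspace rep_space T j}) :
  (forall m : 'I_(dimT i j), (m < k)%N -> T_basis F m \in V) <->
  (flag k j <= V)%VS.
Proof.
split=> [h|/subvP h m mk].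
  by apply/span_subvP => _ /mapP[m + ->]; rewrite mem_filter => /andP[mk _]; exact: h.
by apply: h; apply: memv_span; exact: mem_flag_basis.
Qed.

(** Row [p] is the basis vector of the same index, or 0 if [p] exceeds the range of the target. *)
Lemma delta_keep_mx m n (p : 'I_m) (k : nat) (V : {vspace 'rV[F]_n}) :
  (forall q : 'I_n, (q < k)%N -> delta_mx 0 q \in V) -> (p < k)%N ->
  delta_mx 0 p *m keep_mx F m n \in V.
Proof.
move=> kV pk; rewrite -rowE; case: (ltnP p n) => pn.
  suff -> : row p (keep_mx F m n) = delta_mx 0 (Ordinal pn) by exact: kV.
  by apply/rowP => q; rewrite !mxE eqxx/= -val_eqE/= eq_sym.
suff -> : row p (keep_mx F m n) = 0 by exact: mem0v.
by apply/rowP => q; rewrite !mxE gtn_eqF// (leq_trans (ltn_ord q) pn).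
Qed.

(** Row [p] is the basis vector of index [p.-1], or 0 if [p] is 0 or [p.-1] is out of range. *)
Lemma delta_shift_mx m n (p : 'I_m) (k : nat) (V : {vspace 'rV[F]_n}) :
  (forall q : 'I_n, (q < k)%N -> delta_mx 0 q \in V) -> (p < k)%N ->
  delta_mx 0 p *m shift_mx F m n \in V.
Proof.
move=> kV pk; rewrite -rowE.
case: (boolP ((0 < p) && (p.-1 < n))%N) => [/andP[p0 pn]|p0n].
  suff -> : row p (shift_mx F m n) = delta_mx 0 (Ordinal pn).
    by apply: kV => /=; rewrite (leq_ltn_trans (leq_pred p)).
  by apply/rowP => q; rewrite !mxE eqxx/= -val_eqE/= -{1}(prednK p0) eqSS eq_sym.
suff -> : row p (shift_mx F m n) = 0 by exact: mem0v.
apply/rowP => q; rewrite !mxE; case: eqP => // pq.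
by move: p0n; rewrite pq /= ltn_ord.
Qed.

Lemma flag_submodule k : is_submodule (flag k).
Proof.
move=> a; rewrite /flag limg_span; apply/span_subvP => _ /mapP[_ /mapP[m + ->] ->].
rewrite mem_filter => /andP[mk _]; rewrite lfunE /=.
have hk := (flag_leP k (flag k (target a))).2 (subvv _).
rewrite /T_basis /T_mx; case: ifP => _; first exact: delta_keep_mx hk mk.
case: ifP => _; first exact: delta_shift_mx hk mk.
case: ifP => _; last by rewrite mulmx0 mem0v.
by case: ifP => _; [exact: delta_shift_mx hk mk|exact: delta_keep_mx hk mk].
Qed.

Lemma dim_le_dimT j (V : {vspace rep_space T j}) : (\dim V <= dimT i j)%N.
Proof. by apply: leq_trans (dimvS (subvf V)) _; rewrite dimvf /dim /= mul1n. Qed.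

Lemma dim_flag k j : (k <= dimT i j)%N -> \dim (flag k j) = k.
Proof.
move=> kd; set E := enum 'I_(dimT i j).
have sizeE : count (fun m : 'I_(dimT i j) => (m < k)%N) E = k.
  by rewrite -sum1_count big_enum_cond -(big_ord_widen _ (fun=> 1%N) kd) sum_nat_const
    card_ord muln1.
apply/eqP; rewrite eqn_leq; apply/andP; split.
  by rewrite -{2}sizeE -size_filter -(size_map (@T_basis F K i j)) dim_span.
(* For the lower bound: the d_j - k remaining basis vectors together with U_k span a space of
   dimension d_j. *)
set rest := [seq T_basis F m | m : 'I_(dimT i j) <- E & ~~ (m < k)%N].
have sub : ({:rep_space T j} <= flag k j + <<rest>>)%VS.
  apply/subvP => v _; rewrite (matrix_sum_delta v) big_ord1.
  apply: rpred_sum => m _; apply: rpredZ; case: (boolP (m < k)%N) => mk.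
    exact: subvP (addvSl _ _) _ (memv_span (mem_flag_basis mk)).
  apply: subvP (addvSr _ _) _ (memv_span _).
  by apply: map_f; rewrite mem_filter mk mem_enum.
have sizeR : (k + size rest = dimT i j)%N.
  by rewrite size_map size_filter -{1}sizeE count_predC size_enum_ord.
have := leq_trans (dimvS sub) (dimv_add_leqif _ _).
rewrite dimvf /dim /= mul1n => le1.
rewrite -(leq_add2r (size rest)) sizeR; apply: leq_trans le1 _.
by rewrite leq_add2l dim_span.
Qed.

Lemma flagS k k' j : (k <= k')%N -> (flag k j <= flag k' j)%VS.
Proof.
move=> kk'; apply/flag_leP => m mk; apply: memv_span; apply: mem_flag_basis.
exact: leq_trans mk kk'.
Qed.

Lemma M_sub_submodule j k : is_submodule (M_sub F i j k).
Proof. exact: generated_submodule. Qed.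

Lemma M_sub_le j k (N : subfamily T) : is_submodule N ->
  (flag k j <= N j)%VS -> sub_le (M_sub F i j k) N.
Proof. by move=> mN /span_subvP h; apply: generated_le => // u /h. Qed.

(** The flag at level k is itself a submodule containing the generators, so generating adds nothing
    at [j]. *)
Lemma M_sub_flag j k : M_sub F i j k j = flag k j.
Proof.
apply/eqP; rewrite eqEsubv; apply/andP; split.
  by apply: M_sub_le => //; exact: flag_submodule.
by apply/span_subvP => u; exact: subset_generated.
Qed.

Lemma M_subS j k k' : (k <= k')%N -> sub_le (M_sub F i j k) (M_sub F i j k').
Proof.
move=> kk'; apply: M_sub_le; first exact: M_sub_submodule.
by rewrite M_sub_flag flagS.
Qed.

End StandardFlag.

(** * Submodules and join irreducibles through the isomorphism *)

Section Isomorphism.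
Variables (F : fieldType) (K : link_diagram) (i : segment K).
Variable Phi : state i -> subfamily (T_rep F i).
Hypothesis isoPhi : kauffman_isomorphism Phi.
Implicit Types (S : state i) (N : subfamily (T_rep F i)).

Let submoduleP S : is_submodule (Phi S). Proof. by case: isoPhi. Qed.
Let surjP N : is_submodule N -> exists S, sub_eq (Phi S) N.
Proof. by case: isoPhi => _ + _ _ _; exact. Qed.
Let injP S S' : sub_eq (Phi S) (Phi S') -> S = S'.
Proof. by case: isoPhi => _ _ + _ _; exact. Qed.
Let leP S S' : state_le S S' <-> sub_le (Phi S) (Phi S').
Proof. by case: isoPhi. Qed.
Let stepP j S S' : ccw_transposition j S S' <->
  [/\ sub_le (Phi S) (Phi S'), (forall k, k != j -> Phi S' k = Phi S k)
    & \dim (Phi S' j) = (\dim (Phi S j)).+1].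
Proof. by case: isoPhi. Qed.

Lemma step_not_ge j S S' : ccw_transposition j S S' -> ~ sub_le (Phi S') (Phi S).
Proof. by move=> /stepP[_ _ dimS'] /(_ j)/dimvS; rewrite dimS' ltnn. Qed.

Lemma state_lt_irr S : ~ state_lt S S.
Proof.
by case/state_lt_last => j [S1 [/leP le1 t]]; exact: step_not_ge t le1.
Qed.

(** N corresponds to a state below S. The last transposition of a sequence from that state to S has
    the required source. *)
Lemma proper_below_step N S : is_submodule N -> sub_le N (Phi S) ->
  ~ sub_le (Phi S) N -> exists j S1, ccw_transposition j S1 S /\ sub_le N (Phi S1).
Proof.
move=> mN NS nSN; have [S0 eS0] := surjP mN.
have /leP [e|/state_lt_last[j [S1 [/leP le01 t]]]] :
    sub_le (Phi S0) (Phi S) by exact: sub_le_trans (sub_eq_le eS0) NS.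
  by case: nSN; rewrite -e; exact: sub_eq_le.
exists j, S1; split=> //; exact: sub_le_trans (sub_eq_le (sub_eq_sym eS0)) le01.
Qed.

(** A transposition at [l != j] leaves the component at [j] unchanged, so the smaller module would
    still contain the generators X, hence all of [Phi S]. *)
Lemma step_label j S S1 l (X : seq (rep_space (T_rep F i) j)) :
  {subset X <= Phi S j} ->
  (forall N, is_submodule N -> {subset X <= N j} -> sub_le (Phi S) N) ->
  ccw_transposition l S1 S -> l = j.
Proof.
move=> XS genS t; apply/eqP/negPn/negP => lj; apply: (step_not_ge t).
apply: genS => // u /XS; by case/stepP: t => _ e _; rewrite e// eq_sym.
Qed.

(** P1 is generated by U_k and P2 by N_j, and S is the state of P1 + P2. The sum equals P1 or P2;
    either way one of U_k, N_j contains the other, and their dimensions agree. *)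
Lemma submodule_flag N j : is_submodule N -> N j = flag F i (\dim (N j)) j.
Proof.
move=> mN; set k := \dim (N j).
have kd : (k <= dimT i j)%N by exact: dim_le_dimT.
set P1 := M_sub F i j k.
set P2 := generated (vbasis (N j) : seq (rep_space (T_rep F i) j)).
have m1 : is_submodule P1 by exact: M_sub_submodule.
have m2 : is_submodule P2 by exact: generated_submodule.
have P2N : sub_le P2 N by apply: generated_le => // u; exact: vbasis_mem.
have NP2 : (N j <= P2 j)%VS.
  rewrite -(span_basis (vbasisP (N j))); apply/span_subvP; exact: subset_generated.
have [S eS] := surjP (sub_add_submodule m1 m2).
have le1 : sub_le P1 (Phi S) by move=> l; rewrite eS addvSl.
have le2 : sub_le P2 (Phi S) by move=> l; rewrite eS addvSr.
have genS N' : is_submodule N' ->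
    {subset flag_basis F i j k ++ vbasis (N j) <= N' j} -> sub_le (Phi S) N'.
  move=> mN' XN' l; rewrite eS subv_add; apply/andP; split.
    by apply: generated_le => // u uX; apply: XN'; rewrite mem_cat uX.
  by apply: generated_le => // u uX; apply: XN'; rewrite mem_cat uX orbT.
have XS : {subset flag_basis F i j k ++ vbasis (N j) <= Phi S j}.
  move=> u; rewrite mem_cat => /orP[] uX.
    by apply: subvP (le1 j) _ (subset_generated _).
  by apply: subvP (le2 j) _ (subset_generated _).
have [ge1|nge1] := pselect (sub_le (Phi S) P1).
  apply/eqP; rewrite eqEdim dim_flag// leqnn andbT -M_sub_flag.
  exact: subv_trans (subv_trans NP2 (le2 j)) (ge1 j).
have [ge2|nge2] := pselect (sub_le (Phi S) P2).
  apply/esym/eqP; rewrite eqEdim dim_flag// leqnn andbT -M_sub_flag.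
  exact: subv_trans (subv_trans (le1 j) (ge2 j)) (P2N j).
(* If both summands were proper, each would lie below a descent of S. Both descents are labeled j,
   so they coincide, and this one smaller module would contain P1 + P2. *)
have [j1 [S1 [t1 le11]]] := proper_below_step m1 le1 nge1.
have [j2 [S2 [t2 le22]]] := proper_below_step m2 le2 nge2.
have e1 := step_label XS genS t1; have e2 := step_label XS genS t2.
subst j1 j2; have e := transposition_inj t1 t2; subst S2.
case: (step_not_ge t1) => l; by rewrite eS subv_add le11 le22.
Qed.

Lemma M_sub_le_submodule j k N : is_submodule N -> (k <= \dim (N j))%N ->
  sub_le (M_sub F i j k) N.
Proof.
by move=> mN kN; apply: M_sub_le => //; rewrite (submodule_flag j mN); exact: flagS.
Qed.

Lemma dim_M_sub j k : (k <= dimT i j)%N -> \dim (M_sub F i j k j) = k.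
Proof. by move=> kd; rewrite M_sub_flag dim_flag. Qed.

Lemma zero_state : exists S, forall N, sub_le (Phi S) N.
Proof.
have [S eS] := surjP (zero_submodule (T_rep F i)).
by exists S => N l; rewrite eS sub0v.
Qed.

(** Let S1 be a descent of S at j, and S2 the state of M(j,k) with k = dim [Phi S j]. Then S is the
    join of S1 and S2: S1 supplies the components away from j, S2 the one at j. Since S differs from
    S1, it equals S2. *)
Lemma join_irreducible_M_sub S : join_irreducible (@state_le K i) S ->
  exists j k, (1 <= k <= dimT i j)%N /\ sub_eq (Phi S) (M_sub F i j k).
Proof.
case=> nmin irr; have [S0 S0le] := zero_state.
have [j [S1 [t _]]] : exists j S1, ccw_transposition j S1 S /\ sub_le (Phi S0) (Phi S1).
  apply: proper_below_step => // SS0; apply: nmin => S'; apply/leP.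
  exact: sub_le_trans SS0 (S0le _).
have /stepP[leS1 eqS1 dimS1] := t; pose k := \dim (Phi S j).
exists j, k; have kd : (k <= dimT i j)%N by exact: dim_le_dimT.
split; first by rewrite kd /k dimS1.
have [S2 eS2] := surjP (M_sub_submodule F i j k).
have le2 : sub_le (Phi S2) (Phi S).
  by apply: sub_le_trans (sub_eq_le eS2) _; exact: M_sub_le_submodule.
have [e|->//] : S = S1 \/ S = S2; last by case: (step_not_ge t); rewrite -e.
apply: irr; split; [exact/leP|exact/leP|move=> U /leP le1U /leP le2U].
apply/leP => l; have [->|lj] := eqVneq l j; last by rewrite eqS1.
apply: subv_trans (le2U j); rewrite eS2 M_sub_flag.
by rewrite {1}(submodule_flag j (submoduleP S)).
Qed.

(** * Join irreducibility and descent of M(j,k) *)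

Section MSubState.
Variables (j : segment K) (k : nat) (S : state i).
Hypothesis kd : (1 <= k <= dimT i j)%N.
Hypothesis eS : sub_eq (Phi S) (M_sub F i j k).

Let dimS : \dim (Phi S j) = k.
Proof. by case/andP: kd => _ ?; rewrite eS dim_M_sub. Qed.

Lemma M_sub_step_label l S1 : ccw_transposition l S1 S -> l = j.
Proof.
apply: (@step_label _ _ _ _ (flag_basis F i j k)) => [u uX|N mN XN].
  by rewrite eS; exact: subset_generated.
by apply: sub_le_trans (sub_eq_le eS) _; exact: generated_le.
Qed.

Lemma M_sub_step : exists S1, ccw_transposition j S1 S.
Proof.
have [S0 S0le] := zero_state.
have [l [S1 [t _]]] : exists l S1, ccw_transposition l S1 S /\ sub_le (Phi S0) (Phi S1).
  apply: proper_below_step => // /(_ j)/dimvS.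
  have /(_ j)/dimvS := S0le (fun=> 0%VS); rewrite dimS dimv0 leqn0 => /eqP ->.
  by rewrite leqNgt; case/andP: kd => ->.
by exists S1; rewrite -(M_sub_step_label t).
Qed.

Lemma M_sub_join_irreducible : join_irreducible (@state_le K i) S.
Proof.
split=> [minS|a b [/leP aS /leP bS joinS]].
  have [S1 t] := M_sub_step; have /leP := minS S1; exact: step_not_ge t.
(* The sum of the two submodules bounds the join from above. *)
have [U eU] := surjP (sub_add_submodule (submoduleP a) (submoduleP b)).
have /leP SU : state_le S U.
  by apply: joinS; apply/leP => l; rewrite eU ?addvSl ?addvSr.
have top c : sub_le (Phi c) (Phi S) -> (k <= \dim (Phi c j))%N -> S = c.
  move=> cS kc; apply: injP; apply: sub_le_anti cS.
  by apply: sub_le_trans (sub_eq_le eS) _; exact: M_sub_le_submodule.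
case: (leqP k (\dim (Phi a j))) => ka; first by left; exact: top.
right; apply: top => //; rewrite leqNgt; apply/negP => kb.
(* Components at j form a chain: were both of dimension less than k, their sum would lie in U_m with
   m < k, yet it contains the k-dimensional [Phi S j]. *)
set m := maxn (\dim (Phi a j)) (\dim (Phi b j)).
have mk : (m < k)%N by rewrite gtn_max ka kb.
have lem c : (\dim (Phi c j) <= m)%N -> (Phi c j <= flag F i m j)%VS.
  by move=> cm; rewrite (submodule_flag j (submoduleP c)); exact: flagS.
have /dimvS : (Phi S j <= flag F i m j)%VS.
  by apply: subv_trans (SU j) _; rewrite eU subv_add !lem ?leq_maxl ?leq_maxr.
case/andP: kd => _ /(leq_trans (ltnW mk)) md.
by rewrite dimS (dim_flag F md) leqNgt mk.
Qed.

Lemma M_sub_unique_descent : unique_descent S j.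
Proof.
have [S1 t] := M_sub_step; exists S1; split=> [S2|l]; last first.
  by split=> [/M_sub_step_label|->].
split=> [/state_covers_transposition[l t2]|->].
  have e := M_sub_step_label t2; subst l; exact: transposition_inj t2 t.
split; first exact: transposition_lt t.
(* A state S3 strictly between S1 and S reaches S by a last transposition, whose source must be S1;
   so S3 is also below S1. *)
case=> S3 [lt13 /state_lt_last[l [S4 [le34 t4]]]].
have e := M_sub_step_label t4; subst l; have e := transposition_inj t4 t; subst S4.
have e : S3 = S1 by apply: injP; apply: sub_le_anti; apply/leP => //; right.
by move: lt13; rewrite e; exact: state_lt_irr.
Qed.

End MSubState.

Lemma unique_descent_uniq S j j' : unique_descent S j -> unique_descent S j' -> j = j'.
Proof.
case=> S1 [cov1 step1] [S2 [cov2 step2]].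
have e : S1 = S2 by apply/cov2/cov1.
by apply/step2; rewrite -e; apply/step1.
Qed.

End Isomorphism.

Theorem proposition4p2 (R : realType) (F : closedFieldType) (K : link_diagram)
    (i : segment K) (Phi : state i -> subfamily (T_rep F i)) :
  prime_link_diagram R K ->
  without_curls K ->
  kauffman_isomorphism Phi ->
  ((forall S : state i, join_irreducible (@state_le K i) S ->
      exists (j : segment K) (k : nat),
        (1 <= k <= dimT i j)%N /\ sub_eq (Phi S) (M_sub F i j k)) /\
   (forall (j : segment K) (k : nat), (1 <= k <= dimT i j)%N ->
      exists S : state i,
        join_irreducible (@state_le K i) S /\
        sub_eq (Phi S) (M_sub F i j k))) /\
  (forall (j : segment K) (k : nat) (S : state i), (1 <= k <= dimT i j)%N ->
     sub_eq (Phi S) (M_sub F i j k) -> unique_descent S j) /\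
  (forall j : segment K,
     (forall S : state i,
        (join_irreducible (@state_le K i) S /\ unique_descent S j) <->
        (exists k : nat,
           (1 <= k <= dimT i j)%N /\ sub_eq (Phi S) (M_sub F i j k))) /\
     (forall S S' : state i,
        join_irreducible (@state_le K i) S -> unique_descent S j ->
        join_irreducible (@state_le K i) S' -> unique_descent S' j ->
        state_le S S' \/ state_le S' S) /\
     (forall k : nat, (1 <= k < dimT i j)%N ->
        sub_lt (M_sub F i j k) (M_sub F i j k.+1))).
Proof.
move=> _ _ iso.
have charJ j S : (join_irreducible (@state_le K i) S /\ unique_descent S j) <->
    (exists k : nat, (1 <= k <= dimT i j)%N /\ sub_eq (Phi S) (M_sub F i j k)).
  split=> [[/(join_irreducible_M_sub iso)[j' [k [kd eS]]] desc]|[k [kd eS]]].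
    (* The module found is some M(j',k); its descent is labeled j', and uniqueness of the label
       gives j' = j. *)
    by have <- := unique_descent_uniq (M_sub_unique_descent iso kd eS) desc; exists k.
  split; [exact: M_sub_join_irreducible kd eS|exact: M_sub_unique_descent kd eS].
have [_ surj _ leP _] := iso.
split; first split.
- exact: join_irreducible_M_sub.
- move=> j k kd; have [S eS] := surj _ (@M_sub_submodule F K i j k).
  by exists S; split=> //; exact: M_sub_join_irreducible kd eS.
split=> [j k S kd eS|j]; first exact: M_sub_unique_descent kd eS.
split; first exact: charJ.
split=> [S S' irrS descS irrS' descS'|k /andP[_ kd]].
  have [k [_ eS]] := (charJ j S).1 (conj irrS descS).
  have [k' [_ eS']] := (charJ j S').1 (conj irrS' descS').
  case: (leqP k k') => kk'; [left|right]; apply/leP => l; rewrite eS eS'.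
    exact: M_subS.
  exact: M_subS (ltnW kk') l.
(* Strictness is read off at j, where the dimensions are k and k + 1. *)
split=> [|/(_ j)/(congr1 (fun V : {vspace _} => \dim V))]; first exact: M_subS.
by rewrite !dim_M_sub ?(ltnW kd)// => /n_Sn.
Qed.
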